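(* For every graph $X$, the natural graph morphism $c(X)\to X$ is a cofibrant replacement (i.e. $c(X)$ is a cofibrant graph and $c(X)\to X$ is a weak equivalence). It is not, in general, a full cofibrant replacement (i.e. there is a graph $X$ for which $c(X)\to X$ is not an acyclic fibration).
   Context: A graph is $X=(X_0,X_1,s,t)$ with a set $X_0$ of nodes, a set $X_1$ of arcs, and functions $s,t:X_1\to X_0$ (source, target). A graph morphism $f:X\to Y$ is a pair $f_0:X_0\to Y_0$, $f_1:X_1\to Y_1$ with $s f_1=f_0 s$, $t f_1=f_0 t$. This is the category $\mathrm{Gph}$. For $n>0$, the cycle graph $\mathbf{C}_n$ has $\mathbb{Z}/n$ as nodes and as arcs, with $s(i)=i+1$, $t(i)=i$; $C_n(X)$ is the set of graph morphisms $\mathbf{C}_n\to X$. Model structure on $\mathrm{Gph}$: weak equivalences are the Acyclic morphisms ($C_n(f)$ bijective for all $n>0$); fibrations are the Surjecting morphisms (for every node $x$, $f$ maps the arcs with source $x$ onto the arcs with source $f(x)$); cofibrations are the morphisms with the left lifting property with respect to all acyclic fibrations (Acyclic Surjecting morphisms). A graph $X$ is cofibrant when $0\to X$ is a cofibration ($0$ the empty graph). A cofibrant replacement of $X$ is a weak equivalence $f:X'\to X$ with $X'$ cofibrant; it is full if moreover $f$ is an acyclic fibration. A Z-set is a pair $(S,\sigma)$ with $\sigma:S\to S$ a bijection, with maps the functions commuting with the $\sigma$'s. $G(S,\sigma)$ is the graph with nodes $S$, arcs $S$, $s(x)=\sigma(x)$, $t(x)=x$. $\mathbf{Z}$ is the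 line graph $G(\mathbb{Z},m\mapsto m+1)$. $H(X)$ is the Z-set of graph morphisms $\mathbf{Z}\to X$, with $\sigma$ given by precomposition with the shift $m\mapsto m+1$; $H$ is right adjoint to $G$. $j(S,\sigma)=\{x\in S:\exists n>0,\ \sigma^n(x)=x\}$ with the restricted $\sigma$. Define $c(X)=G(j(H(X)))$; the natural morphism $c(X)\to X$ is the composite $G(j(H(X)))\to G(H(X))\to X$ of $G$ applied to the inclusion with the counit of the adjunction $(G,H)$ (the counit sends a node $f:\mathbf{Z}\to X$ to $f_0(0)$ and an arc $f$ to $f_1(0)$). *)

(* Defs.v *)
From mathcomp Require Import all_boot all_order all_algebra.
From mathcomp Require Import boolp.

Set Implicit Arguments.
Unset Strict Implicit.
Unset Printing Implicit Defensive.

Import GRing.Theory.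

(** * The category of graphs *)

Record graph := Graph {
  node : Type;
  arc : Type;
  src : arc -> node;
  tgt : arc -> node
}.

Record gmor (X Y : graph) := GMor {
  mor0 : node X -> node Y;
  mor1 : arc X -> arc Y;
  mor_src : forall a, src (mor1 a) = mor0 (src a);
  mor_tgt : forall a, tgt (mor1 a) = mor0 (tgt a)
}.

(* Leibniz equality of graph morphisms is equality of the two underlying
   functions. *)
Lemma gmor_ext (X Y : graph) (f g : gmor X Y) :
  mor0 f =1 mor0 g -> mor1 f =1 mor1 g -> f = g.
Proof.
case: f g => [f0 f1 fs ft] [g0 g1 gs gt] /= /funext e0 /funext e1.
rewrite -{}e0 -{}e1 in gs gt *.
by rewrite (Prop_irrelevance fs gs) (Prop_irrelevance ft gt).
Qed.

Lemma gcomp_src (X Y Z : graph) (g : gmor Y Z) (f : gmor X Y) (a : arc X) :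
  src (mor1 g (mor1 f a)) = mor0 g (mor0 f (src a)).
Proof. by rewrite mor_src mor_src. Qed.

Lemma gcomp_tgt (X Y Z : graph) (g : gmor Y Z) (f : gmor X Y) (a : arc X) :
  tgt (mor1 g (mor1 f a)) = mor0 g (mor0 f (tgt a)).
Proof. by rewrite mor_tgt mor_tgt. Qed.

(* [gcomp g f] is "g after f". *)
Definition gcomp (X Y Z : graph) (g : gmor Y Z) (f : gmor X Y) : gmor X Z :=
  GMor (mor0 := fun x => mor0 g (mor0 f x)) (gcomp_src g f) (gcomp_tgt g f).

Definition empty_graph : graph :=
  @Graph void void (fun a => a) (fun a => a).

Definition from_empty (X : graph) : gmor empty_graph X :=
  @GMor empty_graph X (of_void (node X)) (of_void (arc X))
    (fun a => match a with end) (fun a => match a with end).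

(* For n > 0, Z/n is represented by 'I_n with its cyclic successor [ordS];
   'Z_n is not usable here because 'Z_1 has two elements. *)
Definition cycle_graph (n : nat) : graph :=
  @Graph 'I_n 'I_n (@ordS n) (fun i => i).

Definition cycles (n : nat) (X : graph) : Type := gmor (cycle_graph n) X.

Definition cycles_map (n : nat) (X Y : graph) (f : gmor X Y) :
  cycles n X -> cycles n Y := fun c => gcomp f c.

(** * The model structure *)

Definition acyclic (X Y : graph) (f : gmor X Y) : Prop :=
  forall n : nat, 0 < n -> bijective (@cycles_map n X Y f).

Definition surjecting (X Y : graph) (f : gmor X Y) : Prop :=
  forall (x : node X) (b : arc Y), src b = mor0 f x ->
    exists a : arc X, src a = x /\ mor1 f a = b.

Definition weak_equivalence (X Y : graph) (f : gmor X Y) : Prop := acyclic f.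

Definition fibration (X Y : graph) (f : gmor X Y) : Prop := surjecting f.

Definition acyclic_fibration (X Y : graph) (f : gmor X Y) : Prop :=
  weak_equivalence f /\ fibration f.

Definition has_llp (A B X Y : graph) (i : gmor A B) (p : gmor X Y) : Prop :=
  forall (u : gmor A X) (v : gmor B Y), gcomp p u = gcomp v i ->
    exists h : gmor B X, gcomp h i = u /\ gcomp p h = v.

Definition cofibration (A B : graph) (i : gmor A B) : Prop :=
  forall (X Y : graph) (p : gmor X Y), acyclic_fibration p -> has_llp i p.

Definition cofibrant (X : graph) : Prop := cofibration (from_empty X).

Definition cofibrant_replacement (X' X : graph) (f : gmor X' X) : Prop :=
  cofibrant X' /\ weak_equivalence f.

(** * Z-sets *)

Record zset := ZSet {
  zcarrier : Type;
  zperm : zcarrier -> zcarrier;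
  zperm_bij : bijective zperm
}.

Record zmor (S T : zset) := ZMor {
  zfun : zcarrier S -> zcarrier T;
  zfun_perm : forall x, zfun (zperm x) = zperm (zfun x)
}.

Definition G (S : zset) : graph :=
  @Graph (zcarrier S) (zcarrier S) (@zperm S) (fun x => x).

Definition Gmap (S T : zset) (f : zmor S T) : gmor (G S) (G T) :=
  @GMor (G S) (G T) (zfun f) (zfun f)
    (fun x => esym (zfun_perm f x)) (fun x => erefl).

Lemma succz_bij : bijective (fun m : int => (m + 1)%R).
Proof. by exists (fun m : int => (m - 1)%R) => m; rewrite (addrK, subrK). Qed.

Definition int_zset : zset := ZSet succz_bij.

Definition line_graph : graph := G int_zset.

Definition line_shift : gmor line_graph line_graph :=
  Gmap (@ZMor int_zset int_zset (fun m : int => (m + 1)%R) (fun m => erefl)).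

Lemma predz_succ (m : int) : ((m + 1) - 1 = (m - 1) + 1)%R.
Proof. by rewrite addrK subrK. Qed.

Definition line_unshift : gmor line_graph line_graph :=
  Gmap (@ZMor int_zset int_zset (fun m : int => (m - 1)%R) predz_succ).

Lemma H_perm_bij (X : graph) :
  bijective (fun f : gmor line_graph X => gcomp f line_shift).
Proof.
by exists (fun f => gcomp f line_unshift) => f;
  apply: gmor_ext => m /=; rewrite (addrK, subrK).
Qed.

Definition H (X : graph) : zset := ZSet (@H_perm_bij X).

Lemma counit_src (X : graph) (f : arc (G (H X))) :
  src (mor1 f 0%R) = mor0 (src f : gmor line_graph X) 0%R.
Proof. by rewrite mor_src. Qed.

Lemma counit_tgt (X : graph) (f : arc (G (H X))) :
  tgt (mor1 f 0%R) = mor0 (tgt f : gmor line_graph X) 0%R.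
Proof. by rewrite mor_tgt. Qed.

Definition counit (X : graph) : gmor (G (H X)) X :=
  @GMor (G (H X)) X (fun f => mor0 f 0%R) (fun f => mor1 f 0%R)
    (@counit_src X) (@counit_tgt X).

Definition periodic (S : zset) (x : zcarrier S) : Prop :=
  exists n : nat, 0 < n /\ iter n (@zperm S) x = x.

Lemma periodic_perm (S : zset) (x : zcarrier S) :
  periodic x -> periodic (zperm x).
Proof. by case=> n [n0 e]; exists n; rewrite -iterSr iterS e. Qed.

Definition j_perm (S : zset) (x : {x : zcarrier S | periodic x}) :
  {x : zcarrier S | periodic x} :=
  exist _ (zperm (sval x)) (periodic_perm (svalP x)).

Lemma j_perm_bij (S : zset) : bijective (@j_perm S).
Proof.
have [g gK Kg] := zperm_bij S.
have gP (x : zcarrier S) : periodic x -> periodic (g x).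
  case=> n [n0 e]; exists n; split=> //.
  by apply: (can_inj gK); rewrite -iterS iterSr Kg.
exists (fun x => exist _ (g (sval x)) (gP _ (svalP x))) => -[x px];
  by apply: eq_exist; rewrite /= ?gK ?Kg.
Qed.

Definition j (S : zset) : zset := ZSet (@j_perm_bij S).

Definition j_incl (S : zset) : zmor (j S) S :=
  @ZMor (j S) S (fun x => sval x) (fun x => erefl).

(** * The graph c(X) and its natural morphism to X *)

Definition c (X : graph) : graph := G (j (H X)).

Definition c_map (X : graph) : gmor (c X) X :=
  gcomp (counit X) (Gmap (j_incl (H X))).

(* Main.v *)
From mathcomp Require Import all_boot all_order all_algebra.
From mathcomp Require Import boolp.
Require Import Defs.

Set Implicit Arguments.
Unset Strict Implicit.
Unset Printing Implicit Defensive.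

Import GRing.Theory Num.Theory.

(** An n-cycle of [G S] is a point of S fixed by the n-th power of sigma, and
    an n-periodic line in X is an n-cycle of X unwound along Z -> C_n; hence
    [c_map X] is bijective on cycles.  If every point of S is periodic, [G S]
    is a disjoint union of cycles, and each of them lifts uniquely along any
    acyclic morphism, so [G S] is cofibrant.  When X is one node with two
    loops, the constant line at one loop is a node of [c X] with a single
    outgoing arc, so the other loop is missed. *)

(** * Unwinding cycles along the covering of a cycle by the line *)

Lemma wind_proof (n : nat) (m : int) : `|(m %% n.+1)%Z|%N < n.+1.
Proof. by rewrite -ltz_nat gez0_abs ?modz_ge0 // ltz_pmod. Qed.

Definition wind0 (n : nat) (m : int) : 'I_n.+1 := Ordinal (wind_proof n m).

Lemma wind0E (n : nat) (m : int) : Posz (wind0 n m) = (m %% n.+1)%Z.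
Proof. by rewrite /= gez0_abs ?modz_ge0. Qed.

Lemma ordS_wind0 (n : nat) (m : int) :
  ordS (wind0 n m) = wind0 n (m + 1)%R.
Proof.
apply/val_inj/eqP; rewrite -eqz_nat wind0E.
by rewrite /= -modz_nat -addn1 PoszD gez0_abs ?modz_ge0 // modzDml.
Qed.

Lemma wind0_ord (n : nat) (i : 'I_n.+1) : wind0 n i = i.
Proof.
by apply/val_inj/eqP; rewrite -eqz_nat wind0E modz_nat modn_small.
Qed.

Lemma wind0_modr (n : nat) (m : int) (k : nat) :
  wind0 n (m + (k %% n.+1)%N)%R = wind0 n (m + k)%R.
Proof.
by apply/val_inj/eqP; rewrite -eqz_nat !wind0E -modz_nat modzDmr.
Qed.

Lemma wind_src (n k : nat) (m : int) :
  ordS (wind0 n (m + k)%R) = wind0 n ((m + 1) + k)%R.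
Proof. by rewrite ordS_wind0 addrAC. Qed.

(** The covering of the cycle by the line, based at [k]. Taking [k] in [nat] rather than in the
    ordinals lets the shift act as [k.+1], without wrap-around. *)
Definition wind (n k : nat) : gmor line_graph (cycle_graph n.+1) :=
  @GMor line_graph (cycle_graph n.+1)
    (fun m : int => wind0 n (m + k)%R) (fun m : int => wind0 n (m + k)%R)
    (wind_src n k) (fun m => erefl).

Lemma wind_mod (n k : nat) : wind n (k %% n.+1) = wind n k.
Proof. by apply: gmor_ext => m /=; rewrite wind0_modr. Qed.

Lemma wind_shift (n k : nat) : gcomp (wind n k) line_shift = wind n k.+1.
Proof.
by apply: gmor_ext => m; rewrite /= -(addn1 k) PoszD addrAC addrA.
Qed.

Lemma wind_ordS (n : nat) (i : 'I_n.+1) :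
  gcomp (wind n i) line_shift = wind n (ordS i).
(* The value of [ordS i] is [i.+1 %% n.+1] by definition, and [wind] only sees the base point modulo
   [n.+1]. *)
Proof. by rewrite wind_shift -wind_mod. Qed.

Lemma zperm_gcomp (X Y : graph) (g : gmor X Y) (f : gmor line_graph X) (k : nat) :
  iter k (@zperm (H Y)) (gcomp g f) = gcomp g (iter k (@zperm (H X)) f).
Proof. by elim: k => //= k ->; apply: gmor_ext. Qed.

Lemma wind_periodic (n k : nat) (X : graph) (g : cycles n.+1 X) :
  @periodic (H X) (gcomp g (wind n k)).
Proof.
exists n.+1; split=> //; rewrite zperm_gcomp.
have -> p : iter p (@zperm (H (cycle_graph n.+1))) (wind n k) = wind n (k + p).
  elim: p => [|p IHp] /=; first by rewrite addn0.
  by rewrite IHp wind_shift addnS.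
by rewrite -wind_mod modnDr wind_mod.
Qed.

Definition unwound (n : nat) (X : graph) (g : cycles n.+1 X) (i : 'I_n.+1) :
    zcarrier (j (H X)) :=
  exist _ (gcomp g (wind n i)) (wind_periodic i g).

Lemma unwound_src (n : nat) (X : graph) (g : cycles n.+1 X) (i : 'I_n.+1) :
  zperm (unwound g i) = unwound g (ordS i).
Proof. by apply: eq_exist; rewrite -wind_ordS; apply: gmor_ext. Qed.

(** The candidate inverse of [cycles_map (c_map X)]. *)
Definition unwind_cycle (n : nat) (X : graph) (g : cycles n.+1 X) :
    cycles n.+1 (c X) :=
  @GMor (cycle_graph n.+1) (c X) (unwound g) (unwound g)
    (unwound_src g) (fun i => erefl).

Lemma unwind_cycleK (n : nat) (X : graph) :
  cancel (@unwind_cycle n X) (cycles_map (c_map X)).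
Proof. by move=> g; apply: gmor_ext => i /=; rewrite add0r wind0_ord. Qed.

Section CyclesOfC.
Variables (n : nat) (X : graph) (k : cycles n.+1 (c X)).

Let l (i : 'I_n.+1) : gmor line_graph X := sval (mor0 k i).

Lemma cycle_c_arc (i : 'I_n.+1) : mor1 k i = mor0 k i.
Proof. exact: (mor_tgt k i). Qed.

Lemma cycle_c_shift (i : 'I_n.+1) : gcomp (l i) line_shift = l (ordS i).
Proof. by rewrite /l -(mor_src k i) cycle_c_arc. Qed.

Lemma cycle_c_shift_wind (m : int) (p : nat) :
  mor0 (l (wind0 n m)) (p : int) = mor0 (l (wind0 n (m + p)%R)) 0%R /\
  mor1 (l (wind0 n m)) (p : int) = mor1 (l (wind0 n (m + p)%R)) 0%R.
Proof.
elim: p m => [|p IHp] m; first by rewrite addr0.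
have [e0 e1] := IHp (m + 1)%R.
have -> : (m + p.+1 = (m + 1) + p)%R by rewrite -addn1 PoszD addrAC addrA.
by rewrite -e0 -e1 -ordS_wind0 -cycle_c_shift /= -PoszD addn1.
Qed.

(** Successors in the cycle only shift lines forward, so a negative position [-p] is reached by
    starting [p] steps further along the cycle. *)
Lemma cycle_c_unshift_wind (m : int) (p : nat) :
  mor0 (l (wind0 n (m + p)%R)) (- p%:Z)%R = mor0 (l (wind0 n m)) 0%R /\
  mor1 (l (wind0 n (m + p)%R)) (- p%:Z)%R = mor1 (l (wind0 n m)) 0%R.
Proof.
elim: p => [|p [e0 e1]]; first by rewrite addr0.
have -> : (m + p.+1 = (m + p) + 1)%R by rewrite -addn1 PoszD addrA.
rewrite -ordS_wind0 -cycle_c_shift /=.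
have -> : (- p.+1%:Z + 1 = - p%:Z)%R by rewrite -addn1 PoszD opprD subrK.
by split.
Qed.

(** Each line of the cycle is determined by the values at 0 of all its lines, which is exactly what
    [c_map X] retains. *)
Lemma cycle_c_wind (i : 'I_n.+1) (m : int) :
  mor0 (l i) m = mor0 (l (wind0 n (m + i)%R)) 0%R /\
  mor1 (l i) m = mor1 (l (wind0 n (m + i)%R)) 0%R.
Proof.
case: (intP m) => [|p|p].
- by rewrite add0r wind0_ord.
- by have := cycle_c_shift_wind i p.+1; rewrite wind0_ord addrC.
(* The base point is chosen so that [p.+1] steps lead from it to [i]. *)
have := cycle_c_unshift_wind (- p.+1%:Z + i)%R p.+1.
by rewrite addrAC addNr add0r wind0_ord.
Qed.

Lemma cycles_mapK : unwind_cycle (cycles_map (c_map X) k) = k.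
Proof.
have e i : unwound (cycles_map (c_map X) k) i = mor0 k i.
  apply: eq_sig_hprop => [? ? ?|]; first exact: Prop_irrelevance.
  apply: gmor_ext => m /=; have [e0 e1] := cycle_c_wind i m.
    exact/esym.
  by rewrite cycle_c_arc; exact/esym.
by apply: gmor_ext => i /=; rewrite ?cycle_c_arc e.
Qed.

End CyclesOfC.

Lemma c_map_acyclic (X : graph) : acyclic (c_map X).
Proof.
case=> // n _; exists (@unwind_cycle n X); last exact: unwind_cycleK.
exact: cycles_mapK.
Qed.

(** * Lifting periodic orbits along acyclic morphisms *)

Section OrbitCycle.
Variables (S : zset) (n : nat) (x : zcarrier S).
Hypothesis xn : iter n (@zperm S) x = x.

Lemma orbit_src (i : 'I_n) :
  zperm (iter i (@zperm S) x) = iter (ordS i) (@zperm S) x.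
Proof.
(* At the last index [ordS] wraps to 0, and periodicity closes the cycle. *)
rewrite -iterS [nat_of_ord (ordS i)]/=; have := ltn_ord i; rewrite leq_eqVlt => /predU1P[->|lt_in].
  by rewrite modnn xn.
by rewrite modn_small.
Qed.

Definition orbit_cycle : cycles n (G S) :=
  @GMor (cycle_graph n) (G S)
    (fun i : 'I_n => iter i (@zperm S) x) (fun i : 'I_n => iter i (@zperm S) x)
    orbit_src (fun i => erefl).

End OrbitCycle.

Definition cycle_rot (n : nat) : gmor (cycle_graph n) (cycle_graph n) :=
  @GMor (cycle_graph n) (cycle_graph n) (@ordS n) (@ordS n)
    (fun i => erefl) (fun i => erefl).

Lemma orbit_cycle_rot (S : zset) (n : nat) (x : zcarrier S)
    (xn : iter n (@zperm S) x = x)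
    (sxn : iter n (@zperm S) (zperm x) = zperm x) :
  gcomp (orbit_cycle xn) (cycle_rot n) = orbit_cycle sxn.
Proof. by apply: gmor_ext => i /=; rewrite -orbit_src // -iterS iterSr. Qed.

(* [a] is the arc over [x] in the lift to X of the orbit of [x]; its target is
   the node over [x]. *)
Definition orbit_lift (S : zset) (X Y : graph) (p : gmor X Y)
    (v : gmor (G S) Y) (n : nat) (x : zcarrier S) (a : arc X) : Prop :=
  exists (xn : iter n (@zperm S) x = x) (L : cycles n X),
    gcomp p L = gcomp v (orbit_cycle xn) /\
    exists2 z : 'I_n, val z = 0 & mor1 L z = a.

Section OrbitLift.
Variables (S : zset) (X Y : graph) (p : gmor X Y) (v : gmor (G S) Y).
Hypothesis acp : acyclic p.

Lemma orbit_lift_exists (n : nat) (x : zcarrier S) :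
  0 < n -> iter n (@zperm S) x = x -> exists a, orbit_lift p v n x a.
Proof.
move=> n0 xn; have [f _ fK] := acp n0.
pose L := f (gcomp v (orbit_cycle xn)).
exists (mor1 L (Ordinal n0)), xn, L; split; first exact: fK.
by exists (Ordinal n0).
Qed.

(** By injectivity of [p] on [n]-cycles, the lift at [zperm x] is the lift at [x] rotated by one
    step, so consecutive chosen arcs fit together. *)
Lemma orbit_lift_src (n : nat) (x : zcarrier S) (a b : arc X) :
  orbit_lift p v n x a -> orbit_lift p v n (zperm x) b -> src a = tgt b.
Proof.
move=> [xn [L [pL [z z0 <-]]]] [sxn [M [pM [w w0 <-]]]].
have -> : w = z by apply: val_inj; rewrite z0 w0.
have n0 : 0 < n by apply: leq_ltn_trans (ltn_ord z).
have -> : M = gcomp L (cycle_rot n).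
  apply: (bij_inj (acp n0)); rewrite /cycles_map pM -(orbit_cycle_rot xn).
  transitivity (gcomp (gcomp p L) (cycle_rot n)); last exact: gmor_ext.
  by rewrite pL; apply: gmor_ext.
by rewrite mor_src mor_tgt.
Qed.

Lemma orbit_lift_over (n : nat) (x : zcarrier S) (a : arc X) :
  orbit_lift p v n x a -> mor1 p a = mor1 v x.
Proof.
move=> [xn [L [pL [z z0 <-]]]].
have := congr1 (fun h : cycles n Y => mor1 h z) pL.
by rewrite /= [nat_of_ord z]z0.
Qed.

(* Only the dependence of the chosen period on the orbit matters: [xchoose]
   depends on the set of periods, which is the same for [x] and [zperm x]. *)
Lemma invariant_period : (forall x : zcarrier S, periodic x) ->
  exists2 per : zcarrier S -> nat,
    forall x, 0 < per x /\ iter (per x) (@zperm S) x = x &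
    forall x, per (zperm x) = per x.
Proof.
move=> perS; pose P x := [pred n | `[< 0 < n /\ iter n (@zperm S) x = x >]].
have exP x : exists n, P x n by have [n nP] := perS x; exists n; apply/asboolP.
exists (fun x => xchoose (exP x)) => x.
  exact/asboolP/(xchooseP (exP x)).
apply: eq_xchoose => n; apply: asbool_equiv_eq.
rewrite -iterSr iterS; split=> -[n0 e]; split=> //; last by rewrite e.
exact: (bij_inj (zperm_bij S)).
Qed.

Lemma periodic_lift : (forall x : zcarrier S, periodic x) ->
  exists h : gmor (G S) X, gcomp p h = v.
Proof.
move=> /invariant_period[per perP per_perm].
have /choice[h hP] x : exists a, orbit_lift p v (per x) x a.
  by have [n0 xn] := perP x; apply: orbit_lift_exists.
(* Equal periods at [x] and [zperm x] make both lifts cycles of the same length, hence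
   comparable. *)
have hs x : src (h x) = tgt (h (zperm x)).
  by apply: (orbit_lift_src (hP x)); rewrite -[in per _]per_perm.
exists (@GMor (G S) X (fun x => tgt (h x)) h hs (fun x => erefl)).
apply: gmor_ext => x /=; last exact: orbit_lift_over (hP x).
by rewrite -mor_tgt (orbit_lift_over (hP x)) mor_tgt.
Qed.

End OrbitLift.

Lemma G_cofibrant (S : zset) :
  (forall x : zcarrier S, periodic x) -> cofibrant (G S).
Proof.
move=> perS X Y p [acp _] u v _.
have [h ph] := periodic_lift v acp perS.
by exists h; split=> //; apply: gmor_ext; case.
Qed.

Lemma j_periodic (S : zset) (x : zcarrier (j S)) : periodic x.
Proof.
case: x => x xP; have [n [n0 xn]] := xP; exists n; split=> //.
apply: eq_sig_hprop => [? ? ?|]; first exact: Prop_irrelevance.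
rewrite -[RHS]xn /=.
by elim: n {n0 xn} => //= n ->.
Qed.

(** * A graph whose replacement is not full *)

Definition two_loops : graph := @Graph unit bool (fun=> tt) (fun=> tt).

Definition true_line : gmor line_graph two_loops :=
  @GMor line_graph two_loops (fun=> tt) (fun=> true)
    (fun=> erefl) (fun=> erefl).

Lemma true_line_periodic : @periodic (H two_loops) true_line.
Proof. by exists 1; split=> //; apply: gmor_ext. Qed.

Lemma c_two_loops_not_surjecting : ~ surjecting (c_map two_loops).
Proof.
move=> /(_ (exist _ true_line true_line_periodic) false erefl)[a [sa a0]].
(* The shift of [a] is the constant line, so reading that line at -1 reads [a] at 0: the value is
   [true], whereas the lifted arc should be [false]. *)
pose ev (f : zcarrier (j (H two_loops))) :=
  mor1 (sval f : gmor line_graph two_loops) (-1 : int)%R.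
have := congr1 ev sa.
by rewrite /ev /= addNr; move: a0 => /= ->.
Qed.

Theorem mainTheorem9 :
  (forall X : graph, cofibrant_replacement (c_map X)) /\
  (exists X : graph, ~ acyclic_fibration (c_map X)).
Proof.
split=> [X|].
  by split; [apply/G_cofibrant/j_periodic | apply: c_map_acyclic].
by exists two_loops => -[_ /c_two_loops_not_surjecting].
Qed.
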